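(* Let $(X,d,m)$ be a locally compact, connected, separable uniform local tree with a Radon measure $m$ of full support satisfying the uniform volume control with volume growth function $\Phi(r)=r^{d_h}$, $d_h\ge1$ (see context). Let $1<p<\infty$ and $\theta=\frac{(p-1)d_h}{p-1+pd_h}$. There exists a constant $C>0$ such that for every $f\in W^{1,p}(X,m)$ $$\|f\|_{L^p(X,m)}\le C\left(\|f\|_{L^p(X,m)}+\|\partial f\|_{L^p(\mathcal S,\nu)}\right)^{\theta}\|f\|_{L^1(X,m)}^{1-\theta}.$$
   Context: Balls are $B(x,r)=\{y:d(x,y)<r\}$. A metric space $(T,d)$ is a (real) tree if (1) for all $u,v\in T$ there is a unique isometric embedding $\phi_{u,v}:[0,d(u,v)]\to T$ with $\phi_{u,v}(0)=u$, $\phi_{u,v}(d(u,v))=v$; (2) every injective continuous $\kappa:[0,1]\to T$ satisfies $\kappa([0,1])=\phi_{\kappa(0),\kappa(1)}([0,d(\kappa(0),\kappa(1))])$. A metric space $(X,d)$ is a local tree if for every $x\in X$ there is $\iota(x)>0$ such that $B(x,\iota(x))$ is a tree. Standing assumption: $(X,d)$ is a locally compact, connected, separable local tree. For $u,v\in B(x,\iota(x))$, $[u,v]=\phi_{u,v}([0,d(u,v)])$ and $]u,v[=\phi_{u,v}(]0,d(u,v)[)$, geodesics being taken in the tree $B(x,\iota(x))$. The skeleton is $\mathcal S=\bigcup_{x\in X}\bigcup_{y\in B(x,\iota(x))}]x,y[$. Let $\mathcal V$ be a countable dense subset of $\mathcal S$. The length measure $\nu$ is the unique measure on the $\sigma$-field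 generated by the sets $]x,y[$ ($x,y\in\mathcal V$, $d(x,y)<\iota(x)$) with $\nu(]x,y[)=d(x,y)$ for all $x,y\in\mathcal S$ with $d(x,y)<\iota(x)$. Weak gradient: $f\in C(X)$ is absolutely continuous in $B(x,\iota(x))$ if there is $g\in L^1_{loc}(\mathcal S\cap B(x,\iota(x)),\nu)$ (integrable on segments) with $f(u)-f(x)=\int_{]x,u[}g\,d\nu$ for every $u\in B(x,\iota(x))$; $g=:\partial_xf$ is unique $\nu$-a.e. $f\in AC(X)$ means $f$ is absolutely continuous in $B(x,\iota(x))$ for all $x\in X$; then $|\partial_xf|=|\partial_yf|$ $\nu$-a.e. on common domains, and one writes $|\partial f|$. $AC^p(X)$ is the set of $f\in AC(X)$ with $|\partial f|\in L^p(\mathcal S,\nu)$. $m$ is a Radon measure on $X$ with full support. $W^{1,p}(X,m)$ is the set of $f\in L^p(X,m)$ having an $m$-representative $\tilde f\in AC^p(X)$, with $|\partial f|:=|\partial\tilde f|$. Uniform volume control with $\Phi(r)=r^{d_h}$: there are $r_0>0$ and constants $c,C>0$ such that $c\,r^{d_h}\le m(B(x,r))\le C\,r^{d_h}$ for all $x\in X$, $0<r<r_0$. Uniform local tree: there is $0<\underline\iota\le\mathrm{diam}(X)$ such that $B(x,\underline\iota)$ is a tree for every $x\in X$. The inequality is understood as trivial if $\|f\|_{L^1(X,m)}=\infty$. *)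

(* Defs.v *)
From HB Require Import structures.
From mathcomp Require Import all_boot all_order all_algebra.
From mathcomp Require Import all_classical all_reals all_analysis.

Set Implicit Arguments.
Unset Strict Implicit.
Unset Printing Implicit Defensive.

Import Order.TTheory GRing.Theory Num.Theory.
Import numFieldNormedType.Exports.

Local Open Scope classical_set_scope.
Local Open Scope ring_scope.

(* A measurableType is in particular a pointed type, so
   metric spaces are taken pointed here; the point plays no other role. *)
#[short(type="metricPType")]
HB.structure Definition PointedMetric (K : numDomainType) :=
  {M of Metric K M & isPointed M}.

Notation borelType X := (g_sigma_algebraType (@open X)).

Section metric_spaces.
Context {R : realType} {X : metricPType R}.
Implicit Types (T V : set X) (u v x y : X) (iota : X -> R).

Definition diam : \bar R :=
  ereal_sup [set (mdist x y)%:E | x in [set: X] & y in [set: X]].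

Definition separable := exists2 D : set X, countable D & dense D.

(* Isometric embeddings of `[0, mdist u v] into T from u to v; only the values
   of phi on this interval are relevant. *)
Definition geodesic T u v (phi : R -> X) :=
  [/\ phi 0 = u,
      phi (mdist u v) = v,
      {in `[0, mdist u v], forall t, T (phi t)} &
      {in `[0, mdist u v] &, forall s t, mdist (phi s) (phi t) = `|s - t|} ].

(* The segments [u, v] and ]u, v[ of T. The unions range over all geodesics;
   in a tree there is only one, see cseg_tree and oseg_tree. *)
Definition cseg T u v : set X :=
  \bigcup_(phi in geodesic T u v) phi @` `[0, mdist u v]%classic.

Definition oseg T u v : set X :=
  \bigcup_(phi in geodesic T u v) phi @` `]0, mdist u v[%classic.

Definition real_tree T :=
  (forall u v, T u -> T v ->
     exists2 phi, geodesic T u v phi &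
       forall psi, geodesic T u v psi -> {in `[0, mdist u v], psi =1 phi}) /\
  (forall kappa : R -> X,
     {within `[0, 1]%classic, continuous kappa} ->
     {in `[0, 1], forall t, T (kappa t)} ->
     {in `[0, 1] &, injective kappa} ->
     kappa @` `[0, 1]%classic = cseg T (kappa 0) (kappa 1)).

Lemma cseg_tree T u v phi : real_tree T -> T u -> T v ->
  geodesic T u v phi -> cseg T u v = phi @` `[0, mdist u v]%classic.
Proof.
move=> [+ _] Tu Tv gphi => /(_ u v Tu Tv)[rho _ uniq].
apply/seteqP; split=> [z [psi gpsi [t /= t0d <-]]|z [t t0d <-]].
  by exists t => //; rewrite (uniq _ gpsi) // (uniq _ gphi).
by exists phi => //; exists t.
Qed.

Lemma oseg_tree T u v phi : real_tree T -> T u -> T v ->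
  geodesic T u v phi -> oseg T u v = phi @` `]0, mdist u v[%classic.
Proof.
move=> [+ _] Tu Tv gphi => /(_ u v Tu Tv)[rho _ uniq].
apply/seteqP; split=> [z [psi gpsi [t /= t0d <-]]|z [t t0d <-]].
  have t0d' : t \in `[0, mdist u v] by exact: subset_itv_oo_cc.
  by exists t => //; rewrite (uniq _ gpsi) // (uniq _ gphi).
by exists phi => //; exists t.
Qed.

Definition local_tree iota :=
  forall x, 0 < iota x /\ real_tree (ball x (iota x)).

(* The last clause says that the radii iota x, in terms of which the skeleton,
   the length measure and the gradients are defined, respect the uniform
   bound i0. *)
Definition uniform_local_tree iota :=
  exists i0 : R, [/\ 0 < i0,
    (i0%:E <= diam)%E,
    forall x, real_tree (ball x i0) &
    forall x, i0 <= iota x].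

Definition skeleton iota : set X :=
  \bigcup_x \bigcup_(y in ball x (iota x)) oseg (ball x (iota x)) x y.

Definition segments iota V : set (set X) :=
  [set A | exists x y, [/\ V x, V y, mdist x y < iota x &
    A = oseg (ball x (iota x)) x y]].

Definition countable_dense_in V T :=
  [/\ countable V, V `<=` T & T `<=` closure V].

End metric_spaces.

Arguments diam {R} X.
Arguments separable {R} X.

Notation lengthType iota V := (g_sigma_algebraType (segments iota V)).

Section borel_measures.
Context {R : realType} {X : metricPType R}.
Variable m : {measure set (borelType X) -> \bar R}.

Definition radon :=
  (forall K : set X, compact K -> (m K < +oo)%E) /\
  (forall A : set (borelType X), measurable A ->
     m A = ereal_sup [set m K | K in [set K : set X | compact K /\ K `<=` A]]).

Definition full_support :=
  forall O : set X, open O -> O !=set0 -> (0 < m O)%E.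

Definition uniform_volume_control (Phi : R -> R) :=
  exists r0 c C : R, [/\ 0 < r0, 0 < c, 0 < C &
    forall (x : X) (r : R), 0 < r < r0 ->
      ((c * Phi r)%:E <= m (ball x r) <= (C * Phi r)%:E)%E].

End borel_measures.

Section sobolev.
Context {R : realType} {X : metricPType R} (iota : X -> R) (V : set X).
Variable nu : {measure set (lengthType iota V) -> \bar R}.

Local Notation B x := (ball x (iota x) : set (lengthType iota V)).
Local Notation S := (skeleton iota : set (lengthType iota V)).

(* The length measure lives on the skeleton; it is seen as a measure on X
   (for the sigma-field generated on X by the same segments) that does not
   charge the complement of the skeleton. *)
Definition length_measure :=
  nu (~` S) = 0%E /\
  (forall x y, S x -> S y -> mdist x y < iota x ->
     nu (oseg (B x) x y) = (mdist x y)%:E).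

(* g is the gradient of f in the ball B x, based at x. *)
Definition gradient_at x (f : X -> R) (g : lengthType iota V -> R) :=
  [/\ measurable_fun (S `&` B x) g,
      forall u v, B x u -> B x v ->
        nu.-integrable (oseg (B x) u v) (EFin \o g) &
      forall u, B x u ->
        (f u - f x)%:E = (\int[nu]_(z in oseg (B x) x u) (g z)%:E)%E].

Definition is_AC (f : X -> R) :=
  continuous f /\ forall x, exists g, gradient_at x f g.

(* h is |df|: it agrees with the modulus of every local gradient of f. *)
Definition abs_gradient (f : X -> R) (h : lengthType iota V -> R) :=
  measurable_fun S h /\
  forall x g, gradient_at x f g ->
    {ae nu, forall z, (S `&` B x) z -> h z = `|g z|}.

Definition ACp (p : R) (f : X -> R) :=
  is_AC f /\ exists2 h, abs_gradient f h & h \_ S \in Lfun nu p%:E.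

Variable m : {measure set (borelType X) -> \bar R}.

Definition AC_representative (p : R) (f : borelType X -> R) (ft : X -> R) :=
  ACp p ft /\ {ae m, forall x, f x = ft x}.

Definition sobolev (p : R) (f : borelType X -> R) :=
  f \in Lfun m p%:E /\ exists ft, AC_representative p f ft.

Definition sobolev_gradient (p : R) (f : borelType X -> R)
    (h : lengthType iota V -> R) :=
  exists2 ft, AC_representative p f ft & abs_gradient ft h.

End sobolev.

(* Main.v *)
Require Import Defs.
From HB Require Import structures.
From mathcomp Require Import all_boot all_order all_algebra.
From mathcomp Require Import all_classical all_reals all_analysis.
From mathcomp Require Import measurable_realfun ring lra.
Import Order.TTheory GRing.Theory Num.Theory.
Import numFieldNormedType.Exports.
Local Open Scope classical_set_scope.
Local Open Scope ring_scope.

Set Implicit Arguments.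
Unset Strict Implicit.
Unset Printing Implicit Defensive.

(** The inequality is proved at each small scale [r] and then optimised in [r].

    Cover [X] by balls [B_k] of radius [r] centred at points of [V], the number
    of balls through a point being bounded independently of [r]
    ([bounded_overlap_cover]: the concentric balls of radius [r / 3] are disjoint
    and volumes are comparable to [r ^ dh]). On the ball around [c] one has
    [f y - f c = \int_(]c, y[) g dnu], and Hoelder's inequality on this segment
    of measure at most [r] gives
      [|f y - f c| ^ p <= r ^ (p - 1) * \int_U |df| ^ p dnu]
    where [U] is the union of the segments issued from [c] inside the ball
    ([ball_oscillation_le]). A function of small oscillation is close to its
    mean, so
      [\int_B |f| ^ p <= C (m B ^ (1 - p) (\int_B |f|) ^ p
                            + m B r ^ (p - 1) \int_U |df| ^ p)]
    ([oscillation_Lp_le]). Since the balls, hence the sets [U], overlap boundedly,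
    summation yields ([lp_le_scale], [lp_le_all_scales])
      [|f|_p ^ p <= K (r ^ (- a) |f|_1 ^ p + r ^ b |df|_p ^ p)],
    with [a = (p - 1) dh] and [b = dh + p - 1]. The two terms balance when
    [r ^ (a + b) = (|f|_1 / (|f|_p + |df|_p)) ^ p], which produces the exponent
    [theta = a / (a + b)]; if this [r] exceeds the admissible scales, then
    [|f|_p + |df|_p] is bounded by a multiple of [|f|_1] and the inequality is
    trivial ([interpolation_of_scales]).

    Two points of measurability shape the proof. The length measure is defined on
    a sigma-field generated by the segments with endpoints in the countable set
    [V], so increments of [f] are estimated between points of [V] only, and
    extended by continuity: [V] is dense in [X], not just in the skeleton, because
    [X] is connected ([dense_of_dense_in_skeleton]). And a version [df] of the
    gradient is only known to be measurable on the skeleton; it is compared with a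
    version whose extension by zero is measurable on the whole space
    ([ae_le_Lnorm], [abs_gradient_ae_unique]). *)

(** * Sums of integrals over families with bounded overlap *)

Section overlap.
Local Open Scope ereal_scope.
Context {d : measure_display} {T : measurableType d} {R : realType}.
Variable mu : {measure set T -> \bar R}.
Implicit Types (A : (set T)^nat) (P : pred nat) (h : T -> R).

Let measurable_overlap A P : (forall k, measurable (A k)) ->
  measurable_fun setT (fun x => \sum_(k <oo | P k) (\1_(A k) x : R)%:E).
Proof.
move=> mA; apply: ge0_emeasurable_sum => [k x _ _|k _].
  by rewrite lee_fin.
exact/measurable_EFinP.
Qed.

(** Tonelli's theorem for the counting measure and [mu]; a bound from below or
    from above on the multiplicity of the family [A] now bounds the sum. *)
Lemma nneseries_integral_indic A P h : (forall k, measurable (A k)) ->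
  measurable_fun setT h -> (forall x, (0 <= h x)%R) ->
  \sum_(k <oo | P k) \int[mu]_(x in A k) (h x)%:E =
  \int[mu]_x ((h x)%:E * \sum_(k <oo | P k) (\1_(A k) x)%:E).
Proof.
move=> mA mh h0; rewrite eseries_mkcond.
transitivity (\int[mu]_x \sum_(k <oo)
    ((h x)%:E * (if P k then (\1_(A k) x)%:E else 0))); last first.
  apply: eq_integral => x _; rewrite [in RHS]eseries_mkcond nneseriesZl// => k _.
  by case: ifP => // _; rewrite lee_fin.
rewrite integral_nneseries//.
- apply: eq_eseriesr => k _; case: ifP => _; last first.
    by under eq_integral do rewrite mule0; rewrite integral0.
  by rewrite integral_mkcond; apply: eq_integral => x _; rewrite epatch_indic.
- move=> k; apply: emeasurable_funM; first exact/measurable_EFinP.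
  by case: (P k) => //; apply/measurable_EFinP.
- move=> k x _; apply: mule_ge0; first by rewrite lee_fin.
  by case: ifP => // _; rewrite lee_fin.
Qed.

Lemma le_integral_cover A P h : (forall k, measurable (A k)) ->
  measurable_fun setT h -> (forall x, (0 <= h x)%R) ->
  (forall x, exists2 k, P k & A k x) ->
  \int[mu]_x (h x)%:E <= \sum_(k <oo | P k) \int[mu]_(x in A k) (h x)%:E.
Proof.
move=> mA mh h0 cover; rewrite nneseries_integral_indic//.
have msum := @measurable_overlap A P mA.
apply: ge0_le_integral => //.
- by move=> x _; rewrite lee_fin.
- exact/measurable_EFinP.
- by apply: emeasurable_funM; [exact/measurable_EFinP|].
move=> x _; have [k Pk Akx] := cover x.
rewrite lee_pemulr ?lee_fin//.
rewrite (@nneseriesD1 _ _ k)//.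
have -> : \1_(A k) x = 1%R :> R by rewrite indicE mem_set.
by apply: leeDl; apply: nneseries_ge0 => j _ _; rewrite lee_fin.
Qed.

Lemma nneseries_integral_overlap A P h (N : R) : (forall k, measurable (A k)) ->
  measurable_fun setT h -> (forall x, (0 <= h x)%R) ->
  (forall x, \sum_(k <oo | P k) (\1_(A k) x)%:E <= N%:E) ->
  \sum_(k <oo | P k) \int[mu]_(x in A k) (h x)%:E
    <= N%:E * \int[mu]_x (h x)%:E.
Proof.
move=> mA mh h0 AN; rewrite nneseries_integral_indic//.
have msum := @measurable_overlap A P mA.
have [[x0]|T0] := pselect (inhabited T); last first.
  rewrite (_ : setT = set0) ?integral_set0 ?mule0//.
  by apply/seteqP; split => // x _; apply: T0; constructor.
have N0 : (0 <= N)%R.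
  rewrite -lee_fin; apply: le_trans (AN x0); apply: nneseries_ge0 => k _ _.
  by rewrite lee_fin.
rewrite -ge0_integralZl_EFin//; last 2 first.
- by move=> x _; rewrite lee_fin.
- exact/measurable_EFinP.
apply: ge0_le_integral => //.
- move=> x _; apply: mule_ge0; rewrite ?lee_fin//.
  by apply: nneseries_ge0 => k _ _; rewrite lee_fin.
- by apply: emeasurable_funM; [exact/measurable_EFinP|].
- by apply: emeasurable_funM => //; exact/measurable_EFinP.
by move=> x _; rewrite muleC; apply: lee_wpmul2r; rewrite ?lee_fin.
Qed.

End overlap.

(** * Power means and functions of small oscillation *)

Section lp_estimates.
Context {d : measure_display} {T : measurableType d} {R : realType}.
Variable mu : {measure set T -> \bar R}.
Implicit Types (A : set T) (f h : T -> R).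

Lemma le_poweR (r : R) (x y : \bar R) : 0 <= r -> (0 <= x)%E -> (x <= y)%E ->
  (x `^ r <= y `^ r)%E.
Proof.
move=> r0 x0 xy; apply: gt0_ler_poweR => //; rewrite in_itv/= leey andbT//.
exact: le_trans xy.
Qed.

(** Hoelder's inequality for [h] and the indicator of [A]. *)
Lemma poweR_integral_le_measure A h (a p : R) : measurable A -> (mu A <= a%:E)%E ->
  measurable_fun setT h -> 1 < p ->
  ((\int[mu]_(x in A) `|h x|%:E) `^ p
    <= (a `^ (p - 1))%:E * \int[mu]_(x in A) (`|h x| `^ p)%:E)%E.
Proof.
move=> mA muA mh p1.
have p0 : 0 < p by apply: lt_trans p1.
have pB : 0 < p - 1 by rewrite subr_gt0.
(* the conjugate exponent of p *)
pose q := p / (p - 1).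
have q0 : 0 < q by rewrite divr_gt0.
have pq : p^-1 + q^-1 = 1.
  by rewrite /q invf_div -[X in X + _]mul1r -mulrDl addrC subrK divff// gt_eqF.
have mI : measurable_fun setT (\1_A : T -> R) by [].
have hA : measurable_fun setT (h \* \1_A : T -> R) by exact: measurable_funM.
have := hoelder mu hA mI p0 q0 pq.
rewrite Lnorm1.
have -> : (\int[mu]_x `|(EFin \o ((h \* \1_A) \* \1_A)%R) x| =
           \int[mu]_(x in A) (`|h x|)%:E)%E.
  rewrite [RHS]integral_mkcond; apply: eq_integral => x _ /=.
  rewrite patchE indicE; case: (x \in A); rewrite ?mulr1// ?mulr0.
  by rewrite normr0.
move=> H.
have I0 : (0 <= \int[mu]_(x in A) (`|h x|)%:E)%E.
  by apply: integral_ge0 => x _; rewrite lee_fin.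
apply: le_trans (le_poweR (ltW p0) I0 H) _.
rewrite poweRM ?Lnorm_ge0// poweR_Lnorm ?gt_eqF// muleC.
have -> : (\int[mu]_x `|(EFin \o (h \* \1_A)%R) x| `^ p =
           \int[mu]_(x in A) (`|h x| `^ p)%:E)%E.
  rewrite [RHS]integral_mkcond; apply: eq_integral => x _ /=.
  rewrite patchE indicE; case: (x \in A); rewrite ?mulr1// ?mulr0.
  by rewrite normr0 powR0// gt_eqF.
apply: lee_wpmul2r.
  by apply: integral_ge0 => x _; rewrite lee_fin powR_ge0.
have -> : ('N[mu]_q%:E[EFin \o (\1_A : T -> R)] = mu A `^ q^-1)%E.
  rewrite unlock; congr (_ `^ _)%E.
  rewrite -[in RHS](setIT A) -integral_indic//.
  apply: eq_integral => x _ /=; rewrite indicE; case: (x \in A) => /=.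
    by rewrite normr1 powR1.
  by rewrite normr0 powR0// gt_eqF.
rewrite -poweRrM /q invf_div divfK// ?gt_eqF//.
by rewrite -poweR_EFin; apply: le_poweR => //; exact: ltW.
Qed.

Lemma powRD_le_mul (a b p : R) : 0 <= a -> 0 <= b -> 0 <= p ->
  (a + b) `^ p <= 2 `^ p * (a `^ p + b `^ p).
Proof.
move=> a0 b0 p0; rewrite mulrDr -!powRM//.
have [ab|/ltW ba] := leP a b.
- apply: ler_wpDl; first exact: powR_ge0.
  apply: ge0_ler_powR; rewrite ?nnegrE ?addr_ge0 ?mulr_ge0//.
  by rewrite mulr_natl mulr2n lerD2r.
- apply: ler_wpDr; first exact: powR_ge0.
  apply: ge0_ler_powR; rewrite ?nnegrE ?addr_ge0 ?mulr_ge0//.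
  by rewrite mulr_natl mulr2n lerD2l.
Qed.

(** Averaging [|f x| <= |f y| + e] over [y] in [A] bounds [|f x|], hence [f] on
    the whole of [A], by the mean of [|f|] plus a multiple of [e]. The factor
    [v `^ (1 - p)] comes from [mu A * (mu A)^-1 `^ p], as [1 - p < 0]. *)
Lemma oscillation_Lp_le A f (x : T) (v w e p : R) :
  measurable A -> 0 < v -> (v%:E <= mu A <= w%:E)%E ->
  measurable_fun setT f -> A x -> (forall y, A y -> `|f y - f x| <= e) ->
  1 < p ->
  (\int[mu]_(y in A) (`|f y| `^ p)%:E <=
    (2 `^ p * v `^ (1 - p))%:E * (\int[mu]_(y in A) `|f y|%:E) `^ p +
    (4 `^ p * w * e `^ p)%:E)%E.
Proof.
move=> mA v0 /andP[vA Aw] mf Ax osc p1.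
have e0 : 0 <= e by apply: le_trans (osc x Ax).
have p0 : 0 <= p by apply: ltW; apply: lt_trans p1.
have finA : mu A \is a fin_num by rewrite ge0_fin_numE// (le_lt_trans Aw)// ltry.
pose V := fine (mu A).
have VA : mu A = V%:E by rewrite fineK.
have vV : v <= V by rewrite -lee_fin -VA.
have Vw : V <= w by rewrite -lee_fin -VA.
have V0 : 0 < V by apply: lt_le_trans vV.
have mnf : measurable_fun setT (fun y => `|f y|) by exact: measurableT_comp.
have mE (g : T -> R) : measurable_fun setT g -> measurable_fun A (EFin \o g).
  by move=> mg; apply/measurable_EFinP; exact: measurable_funTS.
have I0 : (0 <= \int[mu]_(y in A) `|f y|%:E)%E.
  by apply: integral_ge0 => y _; rewrite lee_fin.
have cstA (r : R) : (\int[mu]_(y in A) r%:E = (r * V)%:E)%E.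
  by rewrite integral_cst// VA EFinM.
have fy y : A y -> `|f y| <= `|f x| + e.
  move=> Ay; rewrite -[f y](subrK (f x)) addrC.
  by apply: le_trans (ler_normD _ _) _; rewrite lerD2l osc.
have fx y : A y -> `|f x| <= `|f y| + e.
  move=> Ay; rewrite -[f x](subrK (f y)) addrC.
  by apply: le_trans (ler_normD _ _) _; rewrite lerD2l distrC osc.
have Ifin : (\int[mu]_(y in A) `|f y|%:E \is a fin_num)%E.
  rewrite ge0_fin_numE//; apply: (@le_lt_trans _ _ ((`|f x| + e) * V)%:E);
    last exact: ltry.
  rewrite -cstA; apply: ge0_le_integral => //.
  exact: mE mnf.
pose L := fine (\int[mu]_(y in A) `|f y|%:E)%E.
have LE : (\int[mu]_(y in A) `|f y|%:E = L%:E)%E by rewrite fineK.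
have L0 : 0 <= L by rewrite -lee_fin -LE.
have fxL : `|f x| <= L / V + e.
  rewrite -(ler_pM2r V0) mulrDl divfK ?gt_eqF// -lee_fin EFinD -LE -!cstA.
  rewrite -ge0_integralD//; last exact: mE.
  apply: ge0_le_integral => //.
  by apply: emeasurable_funD => //; exact: mE mnf.
rewrite LE poweR_EFin.
have bnd y : A y -> `|f y| `^ p <= 2 `^ p * ((L / V) `^ p + 2 `^ p * e `^ p).
  move=> Ay; have LV0 : 0 <= L / V by rewrite divr_ge0// ltW.
  rewrite -[in X in _ <= X](@powRM _ _ e)//.
  apply: le_trans (powRD_le_mul LV0 _ p0); last by rewrite mulr_ge0.
  have LVe0 : 0 <= L / V + 2 * e by apply: addr_ge0 => //; exact: mulr_ge0.
  apply: ge0_ler_powR => //.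
  apply: le_trans (fy _ Ay) _; apply: le_trans (lerD fxL (lexx e)) _.
  by rewrite -addrA mulr_natl mulr2n.
apply: (@le_trans _ _ ((2 `^ p * ((L / V) `^ p + 2 `^ p * e `^ p)) * V)%:E).
  rewrite -cstA; apply: ge0_le_integral => //.
  apply: mE; exact: (measurableT_comp (measurable_powR _)).
rewrite -EFinM -EFinD lee_fin mulrDr mulrDl; apply: lerD.
- rewrite -!mulrA ler_wpM2l ?powR_ge0// powRM ?invr_ge0 ?(ltW V0)//.
  rewrite -mulrA [leRHS]mulrC ler_wpM2l ?powR_ge0//.
  rewrite -powR_inv1 ?(ltW V0)// -powRrM mulN1r.
  rewrite -[X in _ * X]powRr1 ?(ltW V0)// -powRD; last by rewrite (gt_eqF V0) implybT.
  have -> : - p + 1 = - (p - 1) by rewrite opprB addrC.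
  have -> : 1 - p = - (p - 1) by rewrite opprB.
  rewrite !powRN lef_pV2 ?posrE ?powR_gt0//.
  by apply: ge0_ler_powR; rewrite ?nnegrE ?(ltW v0) ?(ltW V0)// subr_ge0 ltW.
- have -> : 4 `^ p = 2 `^ p * 2 `^ p :> R.
    by rewrite -powRM//; congr (_ `^ _); rewrite -natrM.
  rewrite !mulrA -mulrA -[leRHS]mulrA; apply: ler_wpM2l.
    by rewrite mulr_ge0 ?powR_ge0.
  by rewrite mulrC ler_wpM2r ?powR_ge0.
Qed.
End lp_estimates.

(** * Dense sets and covers of metric spaces *)

Lemma countable_enum (T : Type) (V : set T) : countable V -> V !=set0 ->
  exists2 v : nat -> T, (forall k, V (v k)) & forall y, V y -> exists k, v k = y.
Proof.
move=> cV [v0 Vv0]; have [V0|[f]] := pfcard_geP cV; first by rewrite V0 in Vv0.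
exists f => [k|y Vy]; first exact: funS.
by have [k _ fk] : exists2 k, setT k & f k = y; [exact: surj|exists k].
Qed.

Section metric.
Context {R : realType} {X : metricPType R}.
Implicit Types (x y z : X) (V : set X) (iota : X -> R).

Lemma open_mball x (r : R) : open (ball x r).
Proof.
rewrite openE => y; rewrite ballEmdist/= => xy.
apply/nbhs_ballP; exists (r - mdist x y) => /=; first by rewrite subr_gt0.
move=> z; rewrite ballEmdist /= ltrBrDl; apply: le_lt_trans.
exact: metric_triangle.
Qed.

Lemma measurable_mball x (r : R) :
  measurable (ball x r : set (borelType X)).
Proof. by apply: sub_sigma_algebra; exact: open_mball. Qed.

Lemma continuous_borel_measurable (f : X -> R) : continuous f ->
  measurable_fun setT (f : borelType X -> R).
Proof.
move=> cf mD; apply: (measurability _ (RGenOInfty.measurableE R)) => //.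
move=> _ [_ [a ->] <-]; rewrite setTI; apply: sub_sigma_algebra.
move/continuousP: cf; apply; exact: rray_open.
Qed.

(** Otherwise [[set x]] would be both open and closed. *)
Lemma connected_ball_nontrivial x y (e : R) : connected [set: X] -> x != y -> 0 < e ->
  exists2 z, ball x e z & z != x.
Proof.
move=> connX xy e0; apply: contrapT => noz.
have xe : ball x e = [set x].
  apply/seteqP; split => [z xz|_ ->]; last exact: ballxx.
  by apply: contrapT => /eqP zx; apply: noz; exists z.
have : [set x] = [set: X].
  apply: connX; first by exists x.
  - by exists [set x]; rewrite ?setTI// -xe; exact: open_mball.
  - exists [set x]; rewrite ?setTI//; apply: accessible_closed_set1.
    by apply: hausdorff_accessible; exact: metric_hausdorff.
by move/seteqP => [_ /(_ y I)] /= /esym/eqP; exact/negP.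
Qed.

(** The midpoint of a short segment issued from [x] is a skeleton point. *)
Lemma skeleton_meets_ball iota x y (e : R) : connected [set: X] -> x != y ->
  local_tree iota -> 0 < e -> exists2 z, skeleton iota z & ball x e z.
Proof.
move=> connX xy tX e0; have [i0 [geo _]] := tX x.
have m0 : 0 < Num.min e (iota x) by rewrite lt_min e0.
have [z] := connected_ball_nontrivial connX xy m0.
rewrite ballEmdist/= lt_min => /andP[ze zi] zx.
have zB : ball x (iota x) z by rewrite ballEmdist.
have [phi gphi _] := geo x z (ballxx x i0) zB.
have d0 : 0 < mdist x z by rewrite mdist_gt0 eq_sym.
have d2 : 0 < mdist x z / 2 < mdist x z.
  by rewrite divr_gt0//= ltr_pdivrMr// ltr_pMr// ltr1n.
exists (phi (mdist x z / 2)).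
  exists x => //; exists z => //; exists phi => //.
have [phi0 _ _ iso] := gphi; rewrite ballEmdist /= -{1}phi0 iso; last 2 first.
- by rewrite in_itv/= lexx ltW.
- by move: d2 => /andP[? ?]; rewrite in_itv/= !ltW.
move: d2 => /andP[? ?]; rewrite sub0r normrN gtr0_norm//.
exact: lt_trans ze.
Qed.

Lemma oseg_sub_ball T x y (r : R) : mdist x y < r -> oseg T x y `<=` ball x r.
Proof.
move=> xyr z [phi [phi0 phid phiT iso] [t /=]].
rewrite in_itv/= => /andP[t0 td] <-; rewrite ballEmdist/= -{1}phi0 iso; last 2 first.
- by rewrite in_itv/= lexx mdist_ge0.
- by rewrite in_itv/= !ltW.
by rewrite sub0r normrN gtr0_norm//; exact: lt_trans xyr.
Qed.

Lemma oseg_sub T x y : oseg T x y `<=` T.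
Proof.
move=> z [phi [_ _ phiT _] [t /= t0d <-]]; apply: phiT.
exact: subset_itv_oo_cc.
Qed.

(** A maximal family of disjoint balls of radius [rho] centred in [V], blown up
    by a factor 3. It covers [X] because the [rho]-ball around a point of [V] close
    to [z] meets a ball of the family. The small balls of those big balls which
    contain [z] are disjoint subsets, of measure at least [a], of the ball of
    radius [4 * rho] around [z]: there are at most [b / a] of them. *)
Lemma bounded_overlap_cover (m : {measure set (borelType X) -> \bar R})
    (V : set X) (rho a b : R) :
  countable V -> (forall x (e : R), 0 < e -> exists2 v, V v & ball x e v) ->
  0 < rho -> 0 < a ->
  (forall x, (a%:E <= m (ball x rho))%E) ->
  (forall x, (m (ball x (4 * rho)) <= b%:E)%E) ->
  exists (c : nat -> X) (D : pred nat),
    [/\ forall k, V (c k),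
        forall z, exists2 k, D k & ball (c k) (3 * rho) z &
        forall z, (\sum_(k <oo | D k) (\1_(ball (c k) (3 * rho)) z)%:E
          <= (b / a)%:E)%E].
Proof.
move=> cV dV rho0 a0 ma mb.
have [c Vc cV'] : exists2 c : nat -> X, (forall k, V (c k)) &
    forall y, V y -> exists k, c k = y.
  by apply: countable_enum => //; have [v Vv _] := dV point _ rho0; exists v.
have [D [_ tD maxD]] :=
  ex_maximal_disjoint_subcollection (fun k => ball (c k) rho) setT.
exists c, (fun k => k \in D); split => // z.
- have [v Vv zv] := dV z _ rho0.
  have [j jv] := cV' v Vv.
  have [k Dk [w [kw jw]]] : exists2 k, D k & ball (c k) rho `&` ball (c j) rho !=set0.
    apply: contrapT => nok.
    have Dj : ~ D j.
      by move=> Dj; apply: nok; exists j => //; exists (c j); split; exact: ballxx.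
    apply: (maxD (D `|` [set j])) => //.
      split; first by move=> k; left.
      by move=> /(_ j); apply: contra_not Dj; apply; right.
    move=> k l [Dk|->] [Dl|->]//; first exact: tD.
      by move=> h; exfalso; apply: nok; exists k.
    by rewrite setIC => h; exfalso; apply: nok; exists l.
  exists k; first exact/mem_set.
  have -> : 3 * rho = rho + rho + rho by ring.
  apply: (ball_triangle _ (ball_sym zv)); rewrite -jv.
  exact: (ball_triangle kw (ball_sym jw)).
pose Q := [set k | D k /\ ball (c k) (3 * rho) z].
rewrite EFinM lee_pdivlMr// muleC -nneseriesZl; last first.
  by move=> k _; rewrite lee_fin.
apply: (le_trans _ (mb z)).
apply: (@le_trans _ _ (m (\bigcup_(k in Q) ball (c k) rho))); last first.
  apply: le_measure; rewrite ?inE.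
  - by apply: bigcup_measurable => k _; exact: measurable_mball.
  - exact: measurable_mball.
  - apply: bigcup_sub => k [Dk kz] w kw.
    have -> : 4 * rho = 3 * rho + rho by ring.
    exact: (ball_triangle (ball_sym kz) kw).
rewrite measure_bigcup//; last 2 first.
- by move=> k _; exact: measurable_mball.
- by apply: sub_trivIset tD => k [].
rewrite eseries_mkcond [leRHS]eseries_mkcond; apply: lee_nneseries => k _.
  by move=> _; case: ifP => // _; rewrite -EFinM lee_fin mulr_ge0// ltW.
case: ifPn => [/set_mem Dk|_]; last first.
  by case: ifP => // _; exact: le_trans (ma _).
rewrite indicE; have [zk|zk] := pselect (ball (c k) (3 * rho) z).
  by rewrite !mem_set// mule1.
by rewrite memNset// mule0; case: ifP.
Qed.

End metric.

(** * Oscillation of absolutely continuous functions *)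

Section gradient.
Context {R : realType} {X : metricPType R} (iota : X -> R) (V : set X).
Variable nu : {measure set (lengthType iota V) -> \bar R}.
Local Notation B x := (ball x (iota x) : set (lengthType iota V)).
Local Notation S := (skeleton iota : set (lengthType iota V)).
Hypothesis VS : V `<=` S.
Hypothesis hnu : length_measure nu.
Implicit Types (f : X -> R) (h : lengthType iota V -> R).

Lemma measurable_oseg x y : V x -> V y -> mdist x y < iota x ->
  measurable (oseg (B x) x y : set (lengthType iota V)).
Proof. by move=> Vx Vy xy; apply: sub_sigma_algebra; exists x, y. Qed.

(** Integrate the gradient along [oseg (B x) x y], whose measure is less than
    [r], and apply Hoelder's inequality. Both endpoints lie in [V] so that the
    segment belongs to the sigma-field of [nu]. *)
Lemma segment_increment_le x y r p f h : V x -> V y -> mdist x y < r ->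
  mdist x y < iota x -> 1 < p -> (exists g, gradient_at nu x f g) ->
  abs_gradient nu f h -> measurable_fun setT (h \_ S) ->
  ((`|f y - f x| `^ p)%:E <=
    (r `^ (p - 1))%:E *
      \int[nu]_(z in oseg (B x) x y) (`|(h \_ S) z| `^ p)%:E)%E.
Proof.
move=> Vx Vy xr xi p1 [g gradg] [_ habs] mh.
have i0 : 0 < iota x by apply: le_lt_trans xi; exact: mdist_ge0.
have Bx : B x x by exact: ballxx.
have By : B x y by rewrite ballEmdist.
have mA := measurable_oseg Vx Vy xi.
set A := (oseg _ _ _ : set (lengthType iota V)) in mA *.
have AS : A `<=` S `&` B x.
  move=> z Az; split; last exact: oseg_sub Az.
  by exists x => //; exists y.
have nuA : (nu A <= r%:E)%E.
  by rewrite hnu.2 ?lee_fin; [exact: ltW|exact: VS|exact: VS|].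
have hg := habs x g gradg.
have [_ gi gE] := gradg.
have /integrableP[mg _] := gi x y Bx By.
have p0 : 0 <= p by apply: ltW; apply: lt_trans p1.
apply: le_trans (poweR_integral_le_measure mA nuA mh p1).
rewrite -poweR_EFin; apply: le_poweR; rewrite ?lee_fin//.
have -> : (\int[nu]_(z in A) `|(h \_ S) z|%:E = \int[nu]_(z in A) `|g z|%:E)%E.
  apply: ae_eq_integral => //.
  - apply/measurable_EFinP; apply: measurable_funTS.
    exact: measurableT_comp.
  - have /measurable_EFinP mg' := mg.
    by apply/measurable_EFinP; exact: measurableT_comp.
  apply: filterS hg => z hz Az; have [Sz Bz] := AS _ Az.
  by rewrite patchE mem_set// hz// normr_id.
rewrite -abse_EFin (gE y By).
exact: le_abse_integral.
Qed.

(** [U] is the union of the segments from [x] to the points of [V] in the ball: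
    it plays the part of the ball, and being a countable union of generating
    segments it is measurable for [nu]. The bound passes from [V] to the whole
    ball by density and continuity. *)
Lemma ball_oscillation_le x r p f h : countable V ->
  (forall z (e : R), 0 < e -> exists2 v, V v & ball z e v) ->
  V x -> r <= iota x -> 0 < r -> 1 < p -> continuous f ->
  (exists g, gradient_at nu x f g) ->
  abs_gradient nu f h -> measurable_fun setT (h \_ S) ->
  exists U : set (lengthType iota V), [/\ measurable U, U `<=` ball x r &
    forall y, ball x r y -> ((`|f y - f x| `^ p)%:E <=
      (r `^ (p - 1))%:E * \int[nu]_(z in U) (`|(h \_ S) z| `^ p)%:E)%E].
Proof.
move=> cV dV Vx ri r0 p1 cf gradx habs mh.
have [v Vv vV] : exists2 v : nat -> X, (forall k, V (v k)) &
  forall y, V y -> exists k, v k = y by apply: countable_enum => //; exists x.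
pose seg k : set (lengthType iota V) := oseg (B x) x (v k).
pose D := [set k | mdist x (v k) < r].
have mU : measurable (\bigcup_(k in D) seg k).
  apply: bigcup_measurable => k Dk; apply: measurable_oseg => //.
  exact: lt_le_trans ri.
exists (\bigcup_(k in D) seg k); split => //.
  by apply: bigcup_sub => k Dk; exact: oseg_sub_ball.
have p0 : 0 < p by apply: lt_trans p1.
have mH : measurable_fun setT (fun z => (`|(h \_ S) z| `^ p)%:E).
  apply/measurable_EFinP; apply: (measurableT_comp (measurable_powR _)).
  exact: measurableT_comp.
set M := (_ * _)%E.
have bndV k : D k -> ((`|f (v k) - f x| `^ p)%:E <= M)%E.
  move=> Dk; apply: le_trans (segment_increment_le _ _ _ _ p1 gradx habs mh) _ => //.
  - exact: Dk.
  - exact: lt_le_trans ri.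
  - apply: lee_wpmul2l; first by rewrite lee_fin powR_ge0.
    apply: ge0_subset_integral => //.
    + by apply: measurable_oseg => //; exact: lt_le_trans ri.
    + exact: measurable_funTS.
    + by move=> z; exists k.
move=> y xy; rewrite leNgt; apply/negP => My.
have M0 : (0 <= M)%E.
  apply: mule_ge0; first by rewrite lee_fin powR_ge0.
  by apply: integral_ge0 => z _; rewrite lee_fin powR_ge0.
have Mfin : M \is a fin_num by rewrite ge0_fin_numE// (lt_le_trans My)// leey.
pose e := fine M `^ p^-1.
have fM0 : 0 <= fine M by rewrite fine_ge0.
have eM : e `^ p = fine M by rewrite -powRrM mulVf ?gt_eqF// powRr1.
have ey : e < `|f y - f x|.
  rewrite ltNge; apply/negP => ye; move: My; rewrite -(fineK Mfin) lte_fin -eM ltNge.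
  by move=> /negP; apply; apply: ge0_ler_powR; rewrite ?nnegrE ?powR_ge0// ltW.
have cF : `|f z - f x| @[z --> y] --> `|f y - f x|.
  by apply: cvg_norm; apply: cvgB; [exact: cf|exact: cvg_cst].
have evN : \forall z \near y, e < `|f z - f x| by apply: cvgr_gt ey.
have xyN : nbhs y (ball x r).
  by apply: open_nbhs_nbhs; split => //; exact: open_mball.
have /nbhs_ballP[eps /= eps0 epsP] :
    nbhs y (ball x r `&` [set z | e < `|f z - f x|]) by exact: filterI.
have [w Vw /epsP[xw ew]] := dV y eps eps0.
have [k kw] := vV w Vw.
have Dk : D k by rewrite /D/= kw; move: xw; rewrite ballEmdist.
have := bndV k Dk; rewrite kw -(fineK Mfin) lee_fin leNgt -eM => /negP; apply.
by apply: gt0_ltr_powR => //; rewrite nnegrE ?powR_ge0.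
Qed.

End gradient.

(** * The inequality at a fixed scale *)

Section scale.
Context {R : realType} {X : metricPType R} (iota : X -> R) (V : set X).
Variable nu : {measure set (lengthType iota V) -> \bar R}.
Variable m : {measure set (borelType X) -> \bar R}.
Local Notation S := (skeleton iota : set (lengthType iota V)).

(** Sum of the estimates on the balls of a cover with overlap [b / a]. In each
    ball, one factor of [(\int_B |f|) ^ p] is kept and the other [p - 1] are
    bounded by the total mass [L], so that the terms add up. *)
Lemma lp_le_scale (p r v w a b L : R) (f : X -> R) (h : lengthType iota V -> R) :
  V `<=` S -> length_measure nu -> countable V ->
  (forall z (e : R), 0 < e -> exists2 v, V v & ball z e v) ->
  1 < p -> 0 < r -> (forall x, r <= iota x) -> 0 < v -> 0 < a ->
  (forall x, (v%:E <= m (ball x r) <= w%:E)%E) ->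
  (forall x, (a%:E <= m (ball x (r / 3)))%E) ->
  (forall x, (m (ball x (4 * (r / 3))) <= b%:E)%E) ->
  is_AC nu f -> abs_gradient nu f h -> measurable_fun setT (h \_ S) ->
  (\int[nu]_z (`|(h \_ S) z| `^ p)%:E < +oo)%E ->
  (\int[m]_z `|f z|%:E = L%:E)%E ->
  (\int[m]_z (`|f z| `^ p)%:E <= (b / a)%:E *
    ((2 `^ p * v `^ (1 - p) * L `^ p)%:E +
     (4 `^ p * w * r `^ (p - 1))%:E * \int[nu]_z (`|(h \_ S) z| `^ p)%:E))%E.
Proof.
move=> VS hnu cV dV p1 r0 ri v0 a0 mr ma mb [cf gradf] habs mh hfin LE.
have p0 : 0 < p by apply: lt_trans p1.
have r30 : 0 < r / 3 by rewrite divr_gt0.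
have [c [D [Vc cover overlap]]] := bounded_overlap_cover cV dV r30 a0 ma mb.
have r3 : 3 * (r / 3) = r by rewrite mulrC divfK.
rewrite r3 in cover overlap.
set N := b / a in overlap *.
have w0 : 0 <= w.
  rewrite -lee_fin; have /andP[_] := mr point; exact: le_trans.
have /choice[U UP] k : exists U : set (lengthType iota V),
    [/\ measurable U, U `<=` ball (c k) r &
    forall y, ball (c k) r y -> ((`|f y - f (c k)| `^ p)%:E <=
      (r `^ (p - 1))%:E * \int[nu]_(z in U) (`|(h \_ S) z| `^ p)%:E)%E].
  exact: ball_oscillation_le.
pose Bk k : set (borelType X) := ball (c k) r.
pose H z : R := `|(h \_ S) z| `^ p.
have H0 z : 0 <= H z by exact: powR_ge0.
have mH : measurable_fun setT (H : lengthType iota V -> R).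
  by apply: (measurableT_comp (measurable_powR _)); exact: measurableT_comp.
have mf : measurable_fun setT (f : borelType X -> R).
  exact: continuous_borel_measurable.
have mnf : measurable_fun setT (fun z : borelType X => `|f z|).
  exact: measurableT_comp.
have mfp : measurable_fun setT (fun z : borelType X => `|f z| `^ p).
  exact: (measurableT_comp (measurable_powR _)).
have mB k : measurable (Bk k) by exact: measurable_mball.
have mU k : measurable (U k) by have [] := UP k.
have L0 : 0 <= L.
  by rewrite -lee_fin -LE; apply: integral_ge0 => z _; rewrite lee_fin.
pose alpha := 2 `^ p * v `^ (1 - p) * L `^ (p - 1).
pose beta := 4 `^ p * w * r `^ (p - 1).
have alpha0 : 0 <= alpha by rewrite !mulr_ge0// powR_ge0.
have beta0 : 0 <= beta by rewrite !mulr_ge0// powR_ge0.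
have local k : (\int[m]_(z in Bk k) (`|f z| `^ p)%:E <=
    alpha%:E * \int[m]_(z in Bk k) `|f z|%:E +
    beta%:E * \int[nu]_(z in U k) (H z)%:E)%E.
  have [_ _ osc] := UP k.
  have IU0 : (0 <= \int[nu]_(z in U k) (H z)%:E)%E.
    by apply: integral_ge0 => z _; rewrite lee_fin.
  have IUfin : (\int[nu]_(z in U k) (H z)%:E \is a fin_num)%E.
    rewrite ge0_fin_numE//; apply: le_lt_trans hfin.
    apply: ge0_subset_integral => //; first exact/measurable_EFinP.
    by move=> z _; rewrite lee_fin.
  pose E := r `^ (p - 1) * fine (\int[nu]_(z in U k) (H z)%:E)%E.
  have E0 : 0 <= E by rewrite mulr_ge0 ?powR_ge0 ?fine_ge0.
  have Ep : (E `^ p^-1) `^ p = E by rewrite -powRrM mulVf ?gt_eqF// powRr1.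
  have oscE y : Bk k y -> `|f y - f (c k)| <= E `^ p^-1.
    move=> By; have := osc y By; rewrite -(fineK IUfin) -EFinM lee_fin => le1.
    rewrite -[leLHS]powRr1// -(@mulfV _ p) ?gt_eqF// powRrM.
    by apply: ge0_ler_powR; rewrite ?nnegrE ?powR_ge0 ?invr_ge0 ?(ltW p0).
  have ckB : Bk k (c k) by exact: ballxx.
  apply: le_trans (oscillation_Lp_le (mB k) v0 (mr _) mf ckB oscE p1) _.
  apply: leeD; last first.
    by rewrite Ep /E /beta -(fineK IUfin) -EFinM lee_fin !mulrA.
  have IB0 : (0 <= \int[m]_(z in Bk k) `|f z|%:E)%E.
    by apply: integral_ge0 => z _; rewrite lee_fin.
  have IBL : (\int[m]_(z in Bk k) `|f z|%:E <= L%:E)%E.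
    rewrite -LE; apply: ge0_subset_integral => //; first exact/measurable_EFinP.
  have IBfin : (\int[m]_(z in Bk k) `|f z|%:E \is a fin_num)%E.
    by rewrite ge0_fin_numE//; apply: le_lt_trans IBL _; rewrite ltry.
  move: IB0 IBL; rewrite -(fineK IBfin) !lee_fin.
  set l := fine _ => l0 lL.
  rewrite /alpha -[leRHS]mulrA ler_wpM2l ?mulr_ge0 ?powR_ge0//.
  rewrite -mulr_powRB1// mulrC ler_wpM2r//.
  by apply: ge0_ler_powR; rewrite ?nnegrE// subr_ge0 ltW.
have f0 (z : borelType X) : 0 <= `|f z| `^ p by exact: powR_ge0.
apply: le_trans (le_integral_cover (P := D) m mB mfp f0 cover) _.
have IB0 k : (0 <= \int[m]_(z in Bk k) `|f z|%:E)%E.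
  by apply: integral_ge0 => z _; rewrite lee_fin.
have IU0 k : (0 <= \int[nu]_(z in U k) (H z)%:E)%E.
  by apply: integral_ge0 => z _; rewrite lee_fin.
apply: (@le_trans _ _ (\sum_(k <oo | D k)
    (alpha%:E * \int[m]_(z in Bk k) `|f z|%:E +
    beta%:E * \int[nu]_(z in U k) (H z)%:E))%E).
  apply: lee_nneseries => [k _ _|k _]; last exact: local.
  by apply: integral_ge0 => z _; rewrite lee_fin.
rewrite nneseriesD; last 2 first.
- by move=> k _ _; rewrite mule_ge0.
- by move=> k _ _; rewrite mule_ge0.
rewrite !nneseriesZl//.
have N0 : 0 <= N.
  rewrite -lee_fin; apply: le_trans (overlap point).
  by apply: nneseries_ge0 => k _ _; rewrite lee_fin.
rewrite ge0_muleDr; last 2 first.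
- by rewrite lee_fin !mulr_ge0 ?powR_ge0.
- by rewrite mule_ge0// integral_ge0// => z _; rewrite lee_fin.
apply: leeD.
  have := nneseries_integral_overlap (P := D) m mB mnf (fun z => normr_ge0 _) overlap.
  rewrite LE => le1; apply: le_trans (lee_wpmul2l _ le1) _; rewrite ?lee_fin//.
  rewrite /alpha -(mulr_powRB1 L0 p0) le_eqVlt; apply/orP; left; apply/eqP.
  by ring.
have overlapU z : (\sum_(k <oo | D k) (\1_(U k) z)%:E <= N%:E)%E.
  apply: le_trans (overlap z); apply: lee_nneseries => [k _ _|k _].
    by rewrite lee_fin.
  have [_ Usub _] := UP k.
  rewrite lee_fin !indicE; have [Uz|Uz] := pselect (U k z).
    by rewrite !mem_set//; exact: Usub.
  by rewrite (memNset Uz).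
have := nneseries_integral_overlap (P := D) nu mU mH H0 overlapU.
move=> le1; rewrite muleCA; apply: lee_wpmul2l => //.
Qed.

End scale.

(** * Optimisation of the scale *)

(** With [t = L / (A + D)], the right-hand side is a multiple of
    [Y = (A + D) * t `^ (b / (a + b))], and [t `^ (p / (a + b))] is the scale at
    which both terms of the hypothesis are at most [Y `^ p]. If it is not below
    [r1], then [t] is bounded below and [A <= A + D] is enough. *)
Lemma interpolation_of_scales (R : realType) (p a b K r1 A D L : R) :
  0 < p -> 0 < a -> 0 < b ->
  0 <= K -> 0 < r1 -> 0 < A -> 0 <= D -> 0 < L ->
  (forall r, 0 < r < r1 ->
    A `^ p <= K * (r `^ (- a) * L `^ p + r `^ b * D `^ p)) ->
  A <= ((2 * K) `^ p^-1 + r1 `^ (- (b / p))) *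
       (A + D) `^ (a / (a + b)) * L `^ (b / (a + b)).
Proof.
move=> p0 a0 b0 K0 r10 A0 D0 L0 scale.
have s0 : 0 < a + b by exact: addr_gt0.
set G := A + D; have G0 : 0 < G by rewrite ltr_wpDr.
pose t := L / G; have t0 : 0 < t by rewrite divr_gt0.
have YE : G `^ (a / (a + b)) * L `^ (b / (a + b)) = G * t `^ (b / (a + b)).
  have -> : L = G * t by rewrite /t mulrC divfK ?gt_eqF.
  rewrite powRM ?(ltW G0) ?(ltW t0)// mulrA -powRD; last by rewrite (gt_eqF G0) implybT.
  by rewrite -mulrDl divff ?gt_eqF// powRr1// ltW.
rewrite -mulrA YE; set Y := G * _.
have Y0 : 0 <= Y by rewrite mulr_ge0 ?powR_ge0 ?ltW.
rewrite mulrDl.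
have [tr|rt] := ltP (t `^ (p / (a + b))) r1.
- apply: ler_wpDr; first by rewrite mulr_ge0 ?powR_ge0.
  have r0 : 0 < t `^ (p / (a + b)) by exact: powR_gt0.
  have := scale _ (introT andP (conj r0 tr)).
  have Yp : Y `^ p = t `^ (p / (a + b) * b) * G `^ p.
    rewrite powRM ?powR_ge0 ?(ltW G0)// mulrC -powRrM.
    by congr (_ `^ _ * _); rewrite mulrAC [RHS]mulrAC [b * p]mulrC.
  have e1 : (t `^ (p / (a + b))) `^ (- a) * L `^ p = Y `^ p.
    have -> : L = G * t by rewrite /t mulrC divfK ?gt_eqF.
    rewrite powRM ?(ltW G0) ?(ltW t0)// Yp -powRrM mulrCA mulrC -powRD.
      by congr (_ `^ _ * _); field; rewrite gt_eqF.
    by rewrite (gt_eqF t0) implybT.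
  have e2 : (t `^ (p / (a + b))) `^ b * D `^ p <= Y `^ p.
    rewrite -powRrM Yp ler_wpM2l ?powR_ge0//.
    by apply: ge0_ler_powR; rewrite ?nnegrE ?(ltW p0) ?(ltW G0)// /G ler_wpDl// ltW.
  rewrite e1 => Ale.
  have : A `^ p <= ((2 * K) `^ p^-1 * Y) `^ p.
    rewrite powRM ?powR_ge0// -powRrM mulVf ?gt_eqF// powRr1 ?mulr_ge0//.
    apply: le_trans Ale _; rewrite -mulrA mulrCA ler_wpM2l//.
    by rewrite mulr_natl mulr2n lerD2l.
  apply: contraTT; rewrite -!ltNge => YA; apply: gt0_ltr_powR => //.
  - by rewrite nnegrE mulr_ge0 ?powR_ge0.
  - by rewrite nnegrE ltW.
- apply: ler_wpDl; first by rewrite mulr_ge0 ?powR_ge0.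
  rewrite /Y mulrCA; apply: (@le_trans _ _ G); first by rewrite ler_wpDr.
  rewrite -[leLHS]mulr1 ler_wpM2l ?(ltW G0)//.
  rewrite powRN mulrC ler_pdivlMr ?powR_gt0// mul1r.
  have -> : b / (a + b) = p / (a + b) * (b / p) by field; rewrite !gt_eqF.
  rewrite [leRHS]powRrM; apply: ge0_ler_powR => //.
  - by rewrite divr_ge0 ?ltW.
  - by rewrite nnegrE ltW.
  - by rewrite nnegrE powR_ge0.
Qed.

(** * Comparison of norms *)

Section norms.
Local Open Scope ereal_scope.
Context {d : measure_display} {T : measurableType d} {R : realType}.
Variable mu : {measure set T -> \bar R}.
Implicit Types (F G : T -> \bar R) (f g : T -> R).

(** The integral of [G] is a supremum over the simple functions below [G], so it
    dominates that of [F] even if [G] is not measurable: [G] will be built from a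
    modulus of the gradient, which is only known to be measurable on the
    skeleton. *)
Lemma ae_le_integral F G : measurable_fun setT F ->
  (forall x, 0 <= F x) -> (forall x, 0 <= G x) ->
  {ae mu, forall x, F x <= G x} -> \int[mu]_x F x <= \int[mu]_x G x.
Proof.
move=> mF F0 G0 [N [mN N0 FG]].
rewrite (ge0_negligible_integral mN)// integral_mkcond.
have FN0 x : 0 <= (F \_ (setT `\` N)) x by exact: erestrict_ge0.
rewrite !ge0_integralTE//; apply: ereal_sup_le => _ [s /= sF <-]; exists s => // x.
apply: le_trans (sF x) _.
rewrite patchE; case: ifPn => // /set_mem[_ Nx].
by apply: contrapT => xFG; apply: Nx; exact: FG.
Qed.

Lemma Lnorm_EFin_powR f (p : R) : p != 0%R ->
  'N[mu]_p%:E[EFin \o f] `^ p = \int[mu]_x (`|f x| `^ p)%:E.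
Proof. by move=> p0; rewrite poweR_Lnorm. Qed.

Lemma ae_le_Lnorm f g (p : R) : measurable_fun setT f -> (0 < p)%R ->
  {ae mu, forall x, (`|f x| <= `|g x|)%R} ->
  'N[mu]_p%:E[EFin \o f] <= 'N[mu]_p%:E[EFin \o g].
Proof.
move=> mf p0 fg; rewrite unlock; apply: le_poweR.
- by rewrite invr_ge0 ltW.
- by apply: integral_ge0 => x _; exact: poweR_ge0.
apply: ae_le_integral => //.
- apply/measurable_EFinP; apply: (measurableT_comp (measurable_powR _)).
  exact: measurableT_comp.
- by move=> x; exact: poweR_ge0.
- by move=> x; exact: poweR_ge0.
apply: filterS fg => x fgx; apply: le_poweR; rewrite ?lee_fin//.
exact: ltW.
Qed.

Lemma ae_eq_Lnorm f g (p : R) : measurable_fun setT f -> measurable_fun setT g ->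
  (0 < p)%R -> {ae mu, forall x, f x = g x} ->
  'N[mu]_p%:E[EFin \o f] = 'N[mu]_p%:E[EFin \o g].
Proof.
move=> mf mg p0 fg; apply/eqP; rewrite eq_le; apply/andP; split;
  by apply: ae_le_Lnorm => //; apply: filterS fg => x ->.
Qed.
End norms.

(** * Consequences of uniformity *)

Section main_lemmas.
Context {R : realType} {X : metricPType R} (iota : X -> R) (V : set X).
Local Notation S := (skeleton iota : set (lengthType iota V)).

(** The skeleton is dense because no point of [X] is isolated: [X] is connected
    and, its diameter being positive, has more than one point. *)
Lemma dense_of_dense_in_skeleton : connected [set: X] -> local_tree iota ->
  (0 < diam X)%E -> countable_dense_in V (skeleton iota) ->
  forall z (e : R), 0 < e -> exists2 v, V v & ball z e v.
Proof.
move=> connX tX diam0 [cV VS SV] z e e0.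
have [x [y xy]] : exists x y : X, x != y.
  move: diam0 => /ereal_sup_gt[_ [x _ [y _ <-]]].
  by rewrite lte_fin mdist_gt0; exists x, y.
have [s Ss zs] : exists2 s, skeleton iota s & ball z (e / 2) s.
  have e2 : 0 < e / 2 by rewrite divr_gt0.
  have [zy|zy] := eqVneq z y; last exact: skeleton_meets_ball zy _ e2.
  by apply: (@skeleton_meets_ball _ _ _ z x) => //; rewrite zy eq_sym.
have [v [Vv sv]] : V `&` ball s (e / 2) !=set0.
  apply: (SV s Ss); apply: open_nbhs_nbhs; split; first exact: open_mball.
  by apply: ballxx; rewrite divr_gt0.
by exists v => //; rewrite (splitr e); exact: ball_triangle zs sv.
Qed.

(** Two versions agree at almost every skeleton point of each [ball x (iota x)],
    and, the radii being bounded below, countably many of these balls cover [X]. *)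
Lemma abs_gradient_ae_unique (nu : {measure set (lengthType iota V) -> \bar R})
    (f : X -> R) (h k : lengthType iota V -> R) (i0 : R) : 0 < i0 ->
  countable V -> (forall z (e : R), 0 < e -> exists2 v, V v & ball z e v) ->
  (forall x, i0 <= iota x) -> is_AC nu f ->
  abs_gradient nu f h -> abs_gradient nu f k ->
  {ae nu, forall z, (h \_ S) z = (k \_ S) z}.
Proof.
move=> i00 cV dV ii [_ gradf] [_ hh] [_ kk].
have [v Vv vV] : exists2 v : nat -> X, (forall k, V (v k)) &
    forall y, V y -> exists k, v k = y.
  by apply: countable_enum => //; have [w Vw _] := dV point _ i00; exists w.
have : {ae nu, forall z, forall n, (S `&` ball (v n) (iota (v n))) z -> h z = k z}.
  apply: ae_foralln => n; have [g gn] := gradf (v n).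
  have hn := hh _ _ gn; have kn := kk _ _ gn.
  by apply: filterS2 hn kn => z hz kz Sz; rewrite hz ?kz.
apply: filterS => z hz; rewrite !patchE; case: ifPn => // /set_mem Sz.
have [w Vw zw] := dV z _ i00; have [n nw] := vV w Vw.
apply: (hz n); split => //; rewrite nw.
by apply: le_ball (ball_sym zw); exact: ii.
Qed.

(** [lp_le_scale] when the measure of a ball of radius [r] is comparable to
    [r `^ dh]: the overlap is then independent of [r]. *)
Lemma lp_le_all_scales (nu : {measure set (lengthType iota V) -> \bar R})
    (m : {measure set (borelType X) -> \bar R}) (p dh i0 : R) :
  V `<=` S -> length_measure nu -> countable V ->
  (forall z (e : R), 0 < e -> exists2 v, V v & ball z e v) ->
  0 < i0 -> (forall x, i0 <= iota x) ->
  uniform_volume_control m (fun r => r `^ dh) -> 1 < p ->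
  exists K r1 : R, [/\ 0 <= K, 0 < r1 &
    forall (f : X -> R) (h : lengthType iota V -> R) (A D L : R),
      is_AC nu f -> abs_gradient nu f h -> measurable_fun setT (h \_ S) ->
      (\int[m]_z (`|f z| `^ p)%:E = A%:E)%E ->
      (\int[nu]_z (`|(h \_ S) z| `^ p)%:E = D%:E)%E ->
      (\int[m]_z `|f z|%:E = L%:E)%E ->
      forall r, 0 < r < r1 ->
      A <= K * (r `^ (- ((p - 1) * dh)) * L `^ p + r `^ (dh + (p - 1)) * D)].
Proof.
move=> VS hnu cV dV i00 ii [r0 [c [C [r00 c0 C0 vol]]]] p1.
pose N := C / c * 4 `^ dh.
have N0 : 0 <= N by rewrite mulr_ge0 ?powR_ge0// divr_ge0// ltW.
pose K1 := 2 `^ p * c `^ (1 - p); pose K2 := 4 `^ p * C.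
have K10 : 0 <= K1 by rewrite mulr_ge0 ?powR_ge0.
have K20 : 0 <= K2 by rewrite mulr_ge0 ?powR_ge0// ltW.
(* the radius 4 * (r / 3) used to count overlaps must be less than r0 *)
exists (N * (K1 + K2)), (Num.min i0 (r0 / 2)); split.
- by rewrite mulr_ge0// addr_ge0.
- by rewrite lt_min i00 divr_gt0.
move=> f h A D L fAC habs mh AE DE LE r /andP[r_gt0].
rewrite lt_min => /andP[ri rr0].
have D0 : 0 <= D.
  by rewrite -lee_fin -DE; apply: integral_ge0 => z _; rewrite lee_fin powR_ge0.
have volr x : ((c * r `^ dh)%:E <= m (ball x r) <= (C * r `^ dh)%:E)%E.
  by apply: vol; lra.
have vol3 x : ((c * (r / 3) `^ dh)%:E <= m (ball x (r / 3)))%E.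
  have rr : 0 < r / 3 < r0 by lra.
  by have /andP[] := vol x _ rr.
have vol4 x : (m (ball x (4 * (r / 3))) <= (C * (4 * (r / 3)) `^ dh)%:E)%E.
  have rr : 0 < 4 * (r / 3) < r0 by lra.
  by have /andP[] := vol x _ rr.
have ri' x : r <= iota x by apply: le_trans (ltW ri) (ii x).
have cr0 : 0 < c * r `^ dh by rewrite mulr_gt0 ?powR_gt0.
have r3 : 0 < r / 3 by rewrite divr_gt0.
have cr3 : 0 < c * (r / 3) `^ dh by rewrite mulr_gt0 ?powR_gt0.
have hfin : (\int[nu]_z (`|(h \_ S) z| `^ p)%:E < +oo)%E by rewrite DE ltry.
have := lp_le_scale VS hnu cV dV p1 r_gt0 ri' cr0 cr3 volr vol3 vol4
  fAC habs mh hfin LE.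
rewrite AE DE lee_fin => /le_trans; apply.
have -> : C * (4 * (r / 3)) `^ dh / (c * (r / 3) `^ dh) = N.
  rewrite powRM ?(ltW r3)// /N; field.
  by rewrite !gt_eqF// powR_gt0.
rewrite -[leRHS]mulrA ler_wpM2l//.
have -> : (c * r `^ dh) `^ (1 - p) = c `^ (1 - p) * r `^ (- ((p - 1) * dh)).
  rewrite powRM ?powR_ge0 ?(ltW c0)// -powRrM; congr (_ * _ `^ _); ring.
rewrite [r `^ (dh + _)]powRD; last by rewrite (gt_eqF r_gt0) implybT.
set X1 := r `^ - _; set Y1 := r `^ dh; set Z1 := r `^ (p - 1).
rewrite mulrDl !mulrDr -/K1 -/K2.
have X0 : 0 <= X1 by exact: powR_ge0.
have Y0 : 0 <= Y1 by exact: powR_ge0.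
have Z0 : 0 <= Z1 by exact: powR_ge0.
have Lp0 : 0 <= L `^ p by exact: powR_ge0.
have -> : 2 `^ p * (c `^ (1 - p) * X1) * L `^ p = K1 * (X1 * L `^ p).
  by rewrite /K1; ring.
have -> : 4 `^ p * (C * Y1) * Z1 * D = K2 * (Y1 * Z1 * D) by rewrite /K2; ring.
have e1 : 0 <= K1 * (Y1 * Z1 * D) by do 3!apply: mulr_ge0 => //.
have e2 : 0 <= K2 * (X1 * L `^ p) by do 2!apply: mulr_ge0 => //.
lra.
Qed.
End main_lemmas.

(** * The Nash inequality *)

Unset Implicit Arguments.

Theorem theorem3p12 (R : realType) (X : metricPType R)
  (iota : X -> R) (V : set X)
  (nu : {measure set (lengthType iota V) -> \bar R})
  (m : {measure set (borelType X) -> \bar R})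
  (p dh : R)
  (hlc : locally_compact [set: X])
  (hconn : connected [set: X])
  (hsep : separable X)
  (htree : local_tree iota)
  (hunif : uniform_local_tree iota)
  (hV : countable_dense_in V (skeleton iota))
  (hnu : length_measure nu)
  (hradon : radon m)
  (hsupp : full_support m)
  (hdh : 1 <= dh)
  (hvol : uniform_volume_control m (fun r => r `^ dh))
  (hp : 1 < p) :
  let theta := ((p - 1) * dh) / (p - 1 + p * dh) in
  exists2 C : R, 0 < C &
    forall (f : borelType X -> R) (df : lengthType iota V -> R),
      sobolev nu m p f -> sobolev_gradient nu m p f df ->
      ('N[m]_p%:E[EFin \o f] <=
        C%:E
        * ('N[m]_p%:E[EFin \o f]
           + 'N[nu]_p%:E[EFin \o (df \_ (skeleton iota))]) `^ theta
        * 'N[m]_1%:E[EFin \o f] `^ (1 - theta))%E.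
Proof.
move=> theta.
have [i0 [i00 i0diam _ ii]] := hunif.
have [cV VS _] := hV.
have dV : forall z (e : R), 0 < e -> exists2 v, V v & ball z e v.
  by apply: dense_of_dense_in_skeleton hV => //; apply: lt_le_trans i0diam.
have p0 : 0 < p by apply: lt_trans hp.
have pN0 : p != 0 by rewrite gt_eqF.
have dh0 : 0 < dh by apply: lt_le_trans hdh.
have pB : 0 < p - 1 by rewrite subr_gt0.
have [K [r1 [K0 r10 scale]]] := lp_le_all_scales VS hnu cV dV i00 ii hvol hp.
pose a := (p - 1) * dh; pose b := dh + (p - 1).
have a0 : 0 < a by rewrite mulr_gt0.
have b0 : 0 < b by rewrite addr_gt0.
have ab : a + b = p - 1 + p * dh by rewrite /a /b; ring.
have ab0 : 0 < a + b by rewrite addr_gt0.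
have thetaE : theta = a / (a + b) by rewrite ab.
have theta0 : 0 <= theta by rewrite thetaE divr_ge0// ltW.
have theta1E : 1 - theta = b / (a + b).
  by rewrite thetaE; field; rewrite gt_eqF.
have theta10 : 0 < 1 - theta by rewrite theta1E divr_gt0.
pose C := (2 * K) `^ p^-1 + r1 `^ (- (b / p)).
have C0 : 0 < C by rewrite ltr_wpDl ?powR_ge0// powR_gt0.
exists C => // f df [fLp _] [ft [[ftAC [h habs hLp]] fft] dfabs].
pose S : set (lengthType iota V) := skeleton iota.
have mf : measurable_fun setT f by exact: set_mem (sub_Lfun_mfun fLp).
have Nf : ('N[m]_p%:E[EFin \o f] < +oo)%E by exact: set_mem (sub_Lfun_finLfun fLp).
have mh : measurable_fun setT (h \_ S) by exact: set_mem (sub_Lfun_mfun hLp).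
have Nh : ('N[nu]_p%:E[EFin \o (h \_ S)] < +oo)%E.
  exact: set_mem (sub_Lfun_finLfun hLp).
have mft : measurable_fun setT (ft : borelType X -> R).
  by apply: continuous_borel_measurable; exact: ftAC.1.
have NhE : ('N[nu]_p%:E[EFin \o (h \_ S)] <=
    'N[nu]_p%:E[EFin \o (df \_ S)])%E.
  apply: ae_le_Lnorm => //.
  have := abs_gradient_ae_unique i00 cV dV ii ftAC habs dfabs.
  by apply: filterS => z ->.
have eqN q : 0 < q -> ('N[m]_q%:E[EFin \o f] = 'N[m]_q%:E[EFin \o ft])%E.
  by move=> q0; exact: ae_eq_Lnorm.
rewrite !eqN// in Nf *.
(* if |f|_p = 0 the left-hand side vanishes; otherwise |f|_p + |df|_p > 0, which
   makes the right-hand side infinite when |f|_1 is infinite *)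
have [A0|A0] := eqVneq ('N[m]_p%:E[EFin \o ft])%E 0%E.
  rewrite [leLHS]A0; apply: mule_ge0; last exact: poweR_ge0.
  by apply: mule_ge0; [rewrite lee_fin ltW|exact: poweR_ge0].
have AE : ('N[m]_p%:E[EFin \o ft] \is a fin_num)%E by rewrite ge0_fin_numE ?Lnorm_ge0.
have DE : ('N[nu]_p%:E[EFin \o (h \_ S)] \is a fin_num)%E.
  by rewrite ge0_fin_numE ?Lnorm_ge0.
pose A := fine ('N[m]_p%:E[EFin \o ft])%E.
pose D := fine ('N[nu]_p%:E[EFin \o (h \_ S)])%E.
have A_gt0 : 0 < A by rewrite fine_gt0// Nf andbT lt0e A0 Lnorm_ge0.
have D0 : 0 <= D by rewrite fine_ge0 ?Lnorm_ge0.
have sum_ge : ((A + D)%:E <= 'N[m]_p%:E[EFin \o ft] +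
    'N[nu]_p%:E[EFin \o (df \_ S)])%E.
  by rewrite EFinD !fineK// leeD2l.
have [Loo|Loo] := eqVneq ('N[m]_1%:E[EFin \o ft])%E +oo%E.
  rewrite Loo poweRyr ?gt_eqF// gt0_muley ?leey// mule_gt0 ?lte_fin// poweR_gt0//.
  by apply: lt_le_trans sum_ge; rewrite lte_fin ltr_wpDr.
have LE : ('N[m]_1%:E[EFin \o ft] \is a fin_num)%E.
  by rewrite ge0_fin_numE ?Lnorm_ge0// ltey.
pose L := fine ('N[m]_1%:E[EFin \o ft])%E.
have L0 : 0 < L.
  rewrite fine_gt0// -ge0_fin_numE ?Lnorm_ge0// LE andbT lt0e Lnorm_ge0 andbT.
  apply: contra_neq A0 => N10.
  have mEft : measurable_fun setT (EFin \o (ft : borelType X -> R)).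
    exact/measurable_EFinP.
  have ft0 := Lnorm_eq0_eq0 mEft lte01 N10.
  rewrite (@ae_eq_Lnorm _ _ _ _ _ (cst 0))//; first exact: Lnorm0.
  by apply: filterS ft0 => x /(_ I)[].
(* now |f|_p, |h|_p and |f|_1 are the real numbers A, D and L *)
have main : A <= C * (A + D) `^ theta * L `^ (1 - theta).
  rewrite theta1E thetaE; apply: interpolation_of_scales => // r rr1.
  apply: scale ftAC habs mh _ _ _ r rr1.
  - by rewrite -Lnorm_EFin_powR// -poweR_EFin fineK.
  - by rewrite -Lnorm_EFin_powR// -poweR_EFin fineK.
  - by rewrite fineK// Lnorm1.
rewrite -(fineK AE) -/A.
apply: (@le_trans _ _ (C * (A + D) `^ theta * L `^ (1 - theta))%:E).
  by rewrite lee_fin.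
rewrite !EFinM -(fineK LE) poweR_EFin; apply: lee_wpmul2r.
  by rewrite lee_fin powR_ge0.
apply: lee_wpmul2l; first by rewrite lee_fin ltW.
rewrite -poweR_EFin; apply: le_poweR => //.
  by rewrite lee_fin addr_ge0// ltW.
by rewrite fineK.
Qed.
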